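(* Let $(u_i,v_i,\omega_i)$, $i=1,2$, be two solutions on $[0,T]$, with the same data, of the boundary layer problem described in the context, in the class described there. Set $\bar u:=u_1-u_2$, $\bar\omega:=\omega_1-\omega_2$, $a_2:=\partial_y\omega_2/\omega_2$, and $$\bar g:=\bar\omega-a_2\bar u=\omega_2\,\partial_y\Bigl(\frac{\bar u}{\omega_2}\Bigr).$$ Then there exists a constant $C_{\sigma,\delta}$, depending only on $\sigma$ and $\delta$, such that (at each time $t\in[0,T]$) $$\Bigl\|\frac{\bar u}{1+y}\Bigr\|_{L^2(\Omega)}+\|\bar\omega\|_{L^2(\Omega)}\le C_{\sigma,\delta}\|\bar g\|_{L^2(\Omega)}.$$
   Context: $\Omega:=\mathbb T\times\mathbb R_+$ with variables $(x,y)$; for $\alpha=(\alpha_1,\alpha_2)$, $D^\alpha=\partial_x^{\alpha_1}\partial_y^{\alpha_2}$. Parameters: $1<n<\frac73$, $s\ge6$ an even integer, $\gamma\ge1$, $\gamma+\frac12<\sigma\le\min\{\frac2{n-1},\gamma+\frac43\}$, $\delta\in(0,\frac12)$. Boundary layer problem, on $[0,T]\times\mathbb T\times\mathbb R_+$: $\partial_tu+u\partial_xu+v\partial_yu-n(\partial_yu)^{n-1}\partial_y^2u+\partial_xp=0$, $\partial_xu+\partial_yv=0$, $u|_{t=0}=u_0$, $u|_{y=0}=v|_{y=0}=0$, $u|_{y\to+\infty}=U$, where $(U,p)(t,x)$ is given, periodic in $x$, with $\partial_tU+U\partial_xU+\partial_xp=0$, and $\omega:=\partial_yu$. Solution class: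 classical solutions with $u_i-U\in L^\infty([0,T];H^{s,\gamma-1})$ and $\omega_i=\partial_yu_i\in L^\infty([0,T];H^{s,\gamma}_{\sigma,\delta})$, where $\|\omega\|_{H^{s,\gamma}}^2:=\sum_{|\alpha|\le s}\|(1+y)^{\gamma+\alpha_2}D^\alpha\omega\|_{L^2(\Omega)}^2$, $H^{s,\gamma}$ is the space where this is finite, and $H^{s,\gamma}_{\sigma,\delta}:=\{\omega\in H^{s,\gamma}:(1+y)^\sigma\omega\ge\delta,\ \sum_{|\alpha|\le2}|(1+y)^{\sigma+\alpha_2}D^\alpha\omega|^2\le\delta^{-2}\}$. ''Same data'' means same $u_0$, $U$, $p$. *)

(* Defs.v *)
From HB Require Import structures.
From mathcomp Require Import all_boot all_order all_algebra.
From mathcomp Require Import all_classical all_reals all_analysis.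

Set Implicit Arguments.
Unset Strict Implicit.
Unset Printing Implicit Defensive.

Import Order.TTheory GRing.Theory Num.Theory.
Import numFieldNormedType.Exports.

Local Open Scope classical_set_scope.
Local Open Scope ring_scope.

(* Functions on T x R_+ (T = R/Z) are total functions R * R -> R that are
   1-periodic in the first variable; their values at z.2 < 0 are irrelevant.
   Derivatives are only ever used at interior points z.2 > 0, so they are the
   usual two-sided ones. *)
Section HalfPlane.
Context {R : realType}.
Implicit Types (f g phi : R * R -> R) (z : R * R).

Definition xperiodic f := forall z, 0 <= z.2 -> f (z.1 + 1, z.2) = f z.

(* A fundamental domain of T x R_+. *)
Definition Omega : set (R * R) := `[0, 1[%classic `*` `]0, +oo[%classic.

Local Notation leb2 := ((@lebesgue_measure R) \x (@lebesgue_measure R))%E.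

Definition L2norm f : \bar R :=
  'N[leb2]_2%:E[EFin \o (f \* \1_Omega)%R]%E.

Definition dx f : R * R -> R := fun z => 'D_((1, 0) : R * R) f z.
Definition dy f : R * R -> R := fun z => 'D_((0, 1) : R * R) f z.

Definition Dxy (a b : nat) f : R * R -> R := iter a dx (iter b dy f).

Fixpoint Ck (k : nat) f : Prop :=
  (forall z, 0 < z.2 -> {for z, continuous f}) /\
  if k is k'.+1 then
    [/\ forall z, 0 < z.2 ->
          derivable f z (1, 0) /\ derivable f z (0, 1),
        Ck k' (dx f) & Ck k' (dy f)]
  else True.

Definition test_function phi :=
  [/\ xperiodic phi, forall k, Ck k phi &
      exists a b : R, 0 < a /\ forall z, phi z != 0 -> a < z.2 < b].

Definition loc_integrable f := forall a b : R, 0 < a ->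
  leb2.-integrable (`[0, 1[%classic `*` `[a, b]%classic) (EFin \o f).

(* g is the distributional derivative d_x^a d_y^b f on T x (0, +oo). *)
Definition weak_derivative (a b : nat) f g :=
  [/\ loc_integrable f, loc_integrable g &
      forall phi, test_function phi ->
        \int[leb2]_(z in Omega) (f z * Dxy a b phi z) =
        (-1) ^+ (a + b) * \int[leb2]_(z in Omega) (g z * phi z)].

Definition weight (r : R) z : R := (1 + z.2) `^ r.

(* Weak derivatives are unique up to null sets, so the infimum ranges over at
   most one value; it is +oo when some weak derivative does not exist. *)
Definition Hnorm (s : nat) (gamma : R) f : \bar R :=
  ereal_inf [set N | exists D : nat -> nat -> R * R -> R,
    (forall a b, (a + b <= s)%N -> weak_derivative a b f (D a b)) /\
    N = ((\sum_(a < s.+1) \sum_(b < s.+1 | (a + b <= s)%N)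
            L2norm (fun z => weight (gamma + b%:R) z * D a b z)%R ^+ 2)
          `^ 2^-1)%E].

Definition Hspace (s : nat) (gamma : R) : set (R * R -> R) :=
  [set f | (Hnorm s gamma f < +oo)%E].

(* The derivatives of order <= 2 in the pointwise bounds are classical ones,
   f being the C^2 representative of its class (H^s embeds in C^2 for s >= 4,
   and s >= 6 in all uses). *)
Definition Hspace_sd (s : nat) (gamma sigma delta : R) : set (R * R -> R) :=
  [set f | [/\ Hspace s gamma f, Ck 2 f,
    forall z, 0 < z.2 -> delta <= weight sigma z * f z &
    forall z, 0 < z.2 ->
      \sum_(a < 3) \sum_(b < 3 | (a + b <= 2)%N)
        `|weight (sigma + b%:R) z * Dxy a b f z| ^+ 2 <= delta ^- 2]].

Definition Linfty (T : R) (N : (R * R -> R) -> \bar R)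
    (X : set (R * R -> R)) (f : R -> R * R -> R) :=
  exists M : R, {ae (@lebesgue_measure R), forall t : R, 0 <= t <= T ->
    X (f t) /\ (N (f t) <= M%:E)%E}.

End HalfPlane.

Section BoundaryLayer.
Context {R : realType}.

Definition admissible (n gamma sigma delta : R) (s : nat) :=
  [/\ 1 < n < 7%:R / 3%:R,
      (6 <= s)%N /\ ~~ odd s,
      1 <= gamma,
      gamma + 2^-1 < sigma <= Num.min (2 / (n - 1)) (gamma + 4%:R / 3%:R) &
      0 < delta < 2^-1].

Record outer_flow (T : R) (U p : R -> R -> R) : Prop := OuterFlow {
  outer_periodic : forall t x : R, 0 <= t <= T ->
    U t (x + 1) = U t x /\ p t (x + 1) = p t x;
  outer_continuous :
    {within [set q : R * R | 0 <= q.1 <= T],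
       continuous (fun q : R * R => U q.1 q.2)};
  outer_derivable : forall t x : R, 0 < t < T ->
    [/\ derivable (U^~ x) t 1, derivable (U t) x 1 & derivable (p t) x 1];
  outer_bernoulli : forall t x : R, 0 < t < T ->
    derive1 (U^~ x) t + U t x * derive1 (U t) x + derive1 (p t) x = 0
}.

Definition continuous_upto (T : R) (f : R -> R * R -> R) :=
  {within [set q : R * (R * R) | 0 <= q.1 <= T /\ 0 <= q.2.2],
     continuous (fun q : R * (R * R) => f q.1 q.2)}.

Definition continuous_inside (T : R) (f : R -> R * R -> R) :=
  {within [set q : R * (R * R) | 0 <= q.1 <= T /\ 0 < q.2.2],
     continuous (fun q : R * (R * R) => f q.1 q.2)}.

(* The vorticity omega is dy (u t). *)
Record classical_solution (n T : R) (U p : R -> R -> R) (u0 : R * R -> R)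
    (u v : R -> R * R -> R) : Prop := ClassicalSolution {
  sol_periodic : forall t : R, 0 <= t <= T -> xperiodic (u t) /\ xperiodic (v t);
  sol_continuous : continuous_upto T u /\ continuous_upto T v;
  sol_derivable : forall (t : R) (z : R * R), 0 <= t <= T -> 0 < z.2 ->
    [/\ derivable (u t) z (1, 0), derivable (u t) z (0, 1),
        derivable (dy (u t)) z (0, 1) & derivable (v t) z (0, 1)];
  sol_derivative_continuous :
    [/\ continuous_inside T (fun t => dx (u t)),
        continuous_inside T (fun t => dy (u t)),
        continuous_inside T (fun t => dy (dy (u t))) &
        continuous_inside T (fun t => dy (v t))];
  sol_derivable_time : forall (t : R) (z : R * R), 0 < t < T -> 0 < z.2 ->
    derivable (u^~ z) t 1;
  sol_momentum : forall (t : R) (z : R * R), 0 < t < T -> 0 < z.2 ->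
    derive1 (u^~ z) t + u t z * dx (u t) z + v t z * dy (u t) z
      - n * dy (u t) z `^ (n - 1) * dy (dy (u t)) z + derive1 (p t) z.1 = 0;
  sol_incompressible : forall (t : R) (z : R * R), 0 <= t <= T -> 0 < z.2 ->
    dx (u t) z + dy (v t) z = 0;
  sol_initial : forall z : R * R, 0 <= z.2 -> u 0 z = u0 z;
  sol_boundary : forall t x : R, 0 <= t <= T -> u t (x, 0) = 0 /\ v t (x, 0) = 0;
  sol_far_field : forall t x : R, 0 <= t <= T ->
    u t (x, y) @[y --> +oo] --> U t x
}.

Definition solution_class (s : nat) (gamma sigma delta T : R)
    (U : R -> R -> R) (u : R -> R * R -> R) :=
  Linfty T (Hnorm s (gamma - 1)) (Hspace s (gamma - 1))
    (fun t z => u t z - U t z.1) /\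
  Linfty T (Hnorm s gamma) (Hspace_sd s gamma sigma delta)
    (fun t => dy (u t)).

End BoundaryLayer.

(* Main.v *)
(* Fix [t] and [x] and set [m = (1 + y) `^ sigma * omega2], which lies between
   [delta] and [delta^-1].  The quotient [q = ubar / m] vanishes at [y = 0] and
   solves [q' = gbar / m - sigma * q / (1 + y)]; multiplying by [q / (1 + y)]
   and integrating gives the Hardy inequality
   [\int (q / (1 + y)) ^+ 2 <= \int (gbar / m) ^+ 2], hence the bound on
   [ubar / (1 + y)].
   Since [|a2| <= delta ^- 2 / (1 + y)], the bound on
   [omegabar = gbar + a2 * ubar] follows, and Tonelli integrates over [x]. *)
Require Import Defs.
From HB Require Import structures.
From mathcomp Require Import all_boot all_order all_algebra.
From mathcomp Require Import all_classical all_reals all_analysis.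
From mathcomp Require Import measurable_realfun ring lra.
Import Order.TTheory GRing.Theory Num.Theory.
Import numFieldNormedType.Exports.
Local Open Scope classical_set_scope.
Local Open Scope ring_scope.

(** * Hardy inequality on the half-line *)

Section HalfLine.
Set Implicit Arguments.
Unset Strict Implicit.
Context {R : realType}.
Local Notation mu := (@lebesgue_measure R).
Local Notation Rpos := (`]0, +oo[%classic : set R).
Implicit Types (f q r : R -> R).

Lemma is_derive_continuous f (x df : R) :
  is_derive x 1 f df -> {for x, continuous f}.
Proof. by case=> + _ => /derivable1_diffP/differentiable_continuous. Qed.

Lemma segment_continuous f (a b : R) : 0 < a ->
  (forall y : R, 0 < y -> {for y, continuous f}) -> {within `[a, b], continuous f}.
Proof.
move=> a0 cf; apply: continuous_in_subspaceT => y /[!inE]/=.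
by rewrite in_itv/= => /andP[ay _]; apply: cf; exact: lt_le_trans ay.
Qed.

Lemma segment_integrable f (a b : R) : 0 < a ->
  (forall y : R, 0 < y -> {for y, continuous f}) ->
  mu.-integrable `[a, b] (EFin \o f).
Proof.
move=> a0 cf; apply: continuous_compact_integrable; first exact: segment_compact.
exact: segment_continuous.
Qed.

Lemma halfline_measurable f :
  (forall y : R, 0 < y -> {for y, continuous f}) -> measurable_fun Rpos f.
Proof.
move=> cf; apply: open_continuous_measurable_fun; first exact: interval_open.
by move=> y /[!inE]/=; rewrite in_itv/= andbT; exact: cf.
Qed.

Lemma continuous_at_sqr {T : topologicalType} (f : T -> R) x :
  {for x, continuous f} -> {for x, continuous (fun y => f y ^+ 2)}.
Proof.
move=> cf; apply: (@continuous_comp _ _ _ f (fun y => y ^+ 2)) => //.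
exact: exprn_continuous.
Qed.

Lemma continuous_div1D f (y : R) : 0 < y ->
  {for y, continuous f} -> {for y, continuous (fun y => f y / (1 + y))}.
Proof.
move=> y0 cf; apply: cvgM => //; apply: cvgV; first by rewrite gt_eqF// addr_gt0.
by apply: cvgD; [exact: cvg_cst|exact: cvg_id].
Qed.

Lemma is_derive_1D (y : R) : is_derive y 1 (fun y : R => 1 + y) 1.
Proof.
have -> : (fun y : R => 1 + y) = cst 1 + id by [].
by apply: is_derive_eq; rewrite add0r.
Qed.

Lemma is_derive_div (f g : R -> R) (y df dg : R) : g y != 0 ->
  is_derive y 1 f df -> is_derive y 1 g dg ->
  is_derive y 1 (fun y => f y / g y) (df / g y - f y * dg / g y ^+ 2).
Proof.
move=> gy0 fP gP.
have dV : is_derive y 1 (fun y : R => (g y)^-1) (- g y ^- 2 * dg).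
  apply: DeriveDef; first by apply: derivableV => //; case: gP.
  by rewrite deriveV// derive_val /GRing.scale.
have -> : (fun y => f y / g y) = f * (fun y => (g y)^-1) by [].
by apply: is_derive_eq; rewrite /GRing.scale/=; field.
Qed.

(** Differentiating the factor [1 / (1 + y)] produces the square that the Hardy inequality has to
    bound, and the leading minus sign makes it appear with coefficient [+1]. *)
Lemma is_derive_sqr_div1D q (y dq : R) : 0 < y -> is_derive y 1 q dq ->
  is_derive y 1 (fun y => - (q y ^+ 2 / (1 + y)))
    ((q y / (1 + y)) ^+ 2 - 2 * q y * dq / (1 + y)).
Proof.
move=> y0 dqy; have y1 : 1 + y != 0 by rewrite gt_eqF// addr_gt0.
have dF := is_derive_div y1 (is_deriveX 2 dqy) (is_derive_1D y).
apply: (is_derive_eq (is_deriveN dF)).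
by rewrite /GRing.scale/= !fctE; field.
Qed.

(* Integrate the derivative of [- q ^+ 2 / (1 + y)]: with [p = q / (1 + y)] it is
   [(2 * s + 1) * p ^+ 2 - 2 * p * r], which is at least [p ^+ 2 - r ^+ 2]. *)
Lemma hardy_segment q r (s a b : R) : 1 <= 2 * s -> 0 < a -> a < b ->
  (forall y : R, 0 < y -> is_derive y 1 q (r y - s * q y / (1 + y))) ->
  (forall y : R, 0 < y -> {for y, continuous r}) ->
  (\int[mu]_(y in `[a, b]) ((q y / (1 + y)) ^+ 2)%:E <=
   (q a ^+ 2)%:E + \int[mu]_(y in `[a, b]) (r y ^+ 2)%:E)%E.
Proof.
move=> s1 a0 ab dq cr.
pose p y := q y / (1 + y).
pose G y := - (q y ^+ 2 / (1 + y)).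
pose dG y := p y ^+ 2 - 2 * q y * (r y - s * q y / (1 + y)) / (1 + y).
have cq (y : R) : 0 < y -> {for y, continuous q}.
  by move=> /dq; exact: is_derive_continuous.
have cp (y : R) : 0 < y -> {for y, continuous p}.
  by move=> y0; exact/continuous_div1D/cq.
have dGP (y : R) : 0 < y -> is_derive y 1 G (dG y).
  by move=> y0; exact/is_derive_sqr_div1D/dq.
have dGE (y : R) : 0 < y -> dG y = (2 * s + 1) * p y ^+ 2 - 2 * (p y * r y).
  by move=> y0; rewrite /dG /p; field; rewrite gt_eqF// addr_gt0.
have cdG (y : R) : 0 < y -> {for y, continuous dG}.
  move=> y0; rewrite /dG.
  apply: cvgB; first exact/continuous_at_sqr/cp.
  apply: (@continuous_div1D (fun y => 2 * q y * (r y - s * q y / (1 + y)))) => //.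
  apply: cvgM; first by apply: cvgM; [exact: cvg_cst|exact: cq].
  apply: cvgB; first exact: cr.
  apply: (@continuous_div1D (fun y => s * q y)) => //.
  by apply: cvgM; [exact: cvg_cst|exact: cq].
have cG (y : R) : 0 < y -> {for y, continuous G}.
  by move=> /dGP; exact: is_derive_continuous.
have FTC : (\int[mu]_(y in `[a, b]) (dG y)%:E = (G b)%:E - (G a)%:E)%E.
  apply: continuous_FTC2 => //; first exact: segment_continuous.
    split.
    - move=> y; rewrite in_itv/= => /andP[ay _].
      by have [] := dGP y (lt_trans a0 ay).
    - by apply: cvg_at_right_filter; exact: cG.
    - by apply: cvg_at_left_filter; apply: cG; exact: lt_trans ab.
  move=> y; rewrite in_itv/= => /andP[ay _].
  by rewrite derive1E; have [] := dGP y (lt_trans a0 ay).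
have ir := segment_integrable b a0 (fun y y0 => continuous_at_sqr (cr y y0)).
have iG := segment_integrable b a0 cdG.
apply: (@le_trans _ _ (\int[mu]_(y in `[a, b]) ((dG y)%:E + (r y ^+ 2)%:E))%E).
  apply: le_integral => //.
  - exact: (segment_integrable b a0 (fun y y0 => continuous_at_sqr (cp y y0))).
  - exact: integrableD iG ir.
  - move=> y /[!inE]/=; rewrite in_itv/= => /andP[ay _].
    have y0 := lt_le_trans a0 ay.
    rewrite lee_fin dGE// -/(p y).
    (* Completing the square: the remainder is nonnegative exactly through [1 <= 2 * s]. *)
    rewrite -subr_ge0 (_ : _ - _ = (p y - r y) ^+ 2 + (2 * s - 1) * p y ^+ 2).
      by rewrite addr_ge0 ?sqr_ge0// mulr_ge0 ?sqr_ge0// subr_ge0.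
    by ring.
rewrite integralD//= FTC leeD2r// -EFinB lee_fin /G opprK.
(* The endpoint term at [b] enters with a minus sign and is dropped; the one at [a] is at most
   [q a ^+ 2] because [1 + a >= 1]. *)
have b1 : 0 <= q b ^+ 2 / (1 + b).
  by rewrite divr_ge0 ?sqr_ge0// addr_ge0// ltW// (lt_trans a0).
have a1 : q a ^+ 2 / (1 + a) <= q a ^+ 2.
  rewrite ler_pdivrMr ?addr_gt0// ler_peMr ?sqr_ge0//.
  by rewrite lerDl ltW.
by lra.
Qed.

(** The segment inequality is applied on an exhaustion of the half-line: monotone convergence
    handles the left side, and the endpoint term vanishes in the limit because [q] tends to [0] at
    the boundary. *)
Lemma hardy_halfline q r (s : R) : 1 <= 2 * s ->
  (forall y : R, 0 < y -> is_derive y 1 q (r y - s * q y / (1 + y))) ->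
  (forall y : R, 0 < y -> {for y, continuous r}) ->
  q y @[y --> 0^'+] --> (0 : R) ->
  (\int[mu]_(y in Rpos) ((q y / (1 + y)) ^+ 2)%:E <=
   \int[mu]_(y in Rpos) (r y ^+ 2)%:E)%E.
Proof.
move=> s1 dq cr q0.
(* Starting at [2] keeps the segment nondegenerate for every [n], as [hardy_segment] asks for
   [a < b]. *)
pose F (n : nat) : set R := `[n.+2%:R^-1, n.+2%:R]%classic.
have FE : Rpos = \bigcup_n F n.
  apply/seteqP; split => [y|y [n _]]; rewrite /F/= !in_itv/= ?andbT; last first.
    by move=> /andP[ny _]; rewrite (lt_le_trans _ ny).
  move=> y0.
  (* This index makes [n.+2] exceed both [y] and [y^-1]. *)
  exists (Num.truncn y + Num.truncn y^-1)%N => //=; rewrite in_itv/=.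
  have y0' : 0 < y^-1 by rewrite invr_gt0.
  have h1 := truncnS_gt y.
  have h2 := truncnS_gt y^-1.
  apply/andP; split.
    rewrite -[leRHS]invrK lef_pV2 ?posrE//.
    by rewrite (le_trans (ltW h2))// ler_nat !ltnS ltnW// ltnS leq_addl.
  by rewrite (le_trans (ltW h1))// ler_nat !ltnS ltnW// ltnS leq_addr.
have mF n : measurable (F n) by exact: measurable_itv.
have nF : nondecreasing_seq F.
  move=> m n mn; rewrite subsetEset => y; rewrite /F/= !in_itv/= => /andP[h1 h2].
  rewrite (le_trans _ h1)/= ?(le_trans h2) ?ler_nat ?ltnS//.
  by rewrite lef_pV2 ?posrE// ler_nat !ltnS.
have FS n : F n `<=` Rpos by rewrite FE; exact: bigcup_sup.
have cq (y : R) : 0 < y -> {for y, continuous q}.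
  by move=> /dq; exact: is_derive_continuous.
have mp : measurable_fun Rpos (fun y => ((q y / (1 + y)) ^+ 2)%:E).
  apply/measurable_EFinP; apply: halfline_measurable => y y0.
  exact/continuous_at_sqr/continuous_div1D/cq.
have mr : measurable_fun Rpos (fun y => (r y ^+ 2)%:E).
  apply/measurable_EFinP; apply: halfline_measurable => y y0.
  exact/continuous_at_sqr/cr.
have cvgP : (\int[mu]_(y in F n) ((q y / (1 + y)) ^+ 2)%:E @[n --> \oo] -->
    \int[mu]_(y in Rpos) ((q y / (1 + y)) ^+ 2)%:E)%E.
  rewrite FE; apply: ge0_nondecreasing_set_cvg_integral => //.
    by move=> n; exact: measurable_funS mp.
  by move=> n y _; rewrite lee_fin sqr_ge0.
have qn : (q n.+2%:R^-1 ^+ 2)%:E @[n --> \oo] --> (0%:E : \bar R).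
  apply: cvg_EFin; first by near=> n.
  rewrite (_ : 0 = 0 ^+ 2 :> R); last by rewrite expr0n.
  apply: (@cvg_comp _ _ _ _ (fun y : R => y ^+ 2)); last exact: exprn_continuous.
  apply: (cvg_at_rightP _ _ _).1 q0 _ _; split => //.
  (* The harmonic sequence is [1 / (n + 1)]; one shift turns it into the left endpoints of [F]. *)
  by have := @cvg_harmonic R; rewrite -(cvg_shiftS).
(* The added [0] is the limit of the endpoint terms; being finite, it keeps the sum defined even
   when the integral of [r ^+ 2] is [+oo]. *)
rewrite -[leRHS]add0e.
apply: (lee_cvg_to cvgP
  (cvgeD _ qn (cvg_cst (\int[mu]_(y in Rpos) (r y ^+ 2)%:E)%E))).
  by rewrite fin_num_adde_defr.
near=> n.
have n0 : 0 < n.+2%:R^-1 :> R by [].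
have nn : n.+2%:R^-1 < n.+2%:R :> R.
  by rewrite (@lt_trans _ _ 1) ?invf_lt1 ?ltr1n.
apply: (le_trans (hardy_segment s1 n0 nn dq cr)).
rewrite leeD2l//.
apply: (ge0_subset_integral mu (mF n) (measurable_itv _) mr) => //.
  by move=> y _; rewrite lee_fin sqr_ge0.
Unshelve. all: by end_near. Qed.
Lemma halfline_ge0_le_integralZ f g (k : R) : 0 <= k ->
  (forall y : R, 0 < y -> {for y, continuous f}) ->
  (forall y : R, 0 < y -> {for y, continuous g}) ->
  (forall y : R, 0 < y -> 0 <= f y <= k * g y) ->
  (forall y : R, 0 < y -> 0 <= g y) ->
  (\int[mu]_(y in Rpos) (f y)%:E <= k%:E * \int[mu]_(y in Rpos) (g y)%:E)%E.
Proof.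
move=> k0 cf cg fg g0.
have mf := (measurable_EFinP _ _).2 (halfline_measurable cf).
have mg := (measurable_EFinP _ _).2 (halfline_measurable cg).
rewrite -ge0_integralZl//; last first.
  by move=> y /=; rewrite in_itv/= andbT lee_fin; exact: g0.
apply: ge0_le_integral => //.
- by move=> y /=; rewrite in_itv/= andbT lee_fin => /fg/andP[].
- by apply: measurable_funeM.
- by move=> y /=; rewrite in_itv/= andbT lee_fin => /fg/andP[].
Qed.

Lemma is_derive_powR1D (s y : R) : 0 < y ->
  is_derive y 1 (fun y : R => (1 + y) `^ s) (s * (1 + y) `^ s / (1 + y)).
Proof.
move=> y0; have y1 : 0 < 1 + y by rewrite addr_gt0.
have dp := is_derive1_powR s y1.
apply: (is_derive_eq (is_derive1_comp dp (is_derive_1D y))).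
rewrite powRB; last by apply/implyP => _; rewrite gt_eqF.
by rewrite powRr1 ?ltW// mulr1 mulrA.
Qed.

(** * Estimates on one vertical fibre through the weighted quotient *)

Section Quotient.
Variables (phi dphi w dw : R -> R) (sigma delta : R).
Hypothesis sigma1 : 1 <= 2 * sigma.
Hypothesis delta0 : 0 < delta.
Hypothesis phiP : forall y : R, 0 < y -> is_derive y 1 phi (dphi y).
Hypothesis wP : forall y : R, 0 < y -> is_derive y 1 w (dw y).
Hypothesis dphi_cont : forall y : R, 0 < y -> {for y, continuous dphi}.
Hypothesis dw_cont : forall y : R, 0 < y -> {for y, continuous dw}.
Hypothesis w_ge : forall y : R, 0 < y -> delta <= (1 + y) `^ sigma * w y.
Hypothesis w_le : forall y : R, 0 < y -> (1 + y) `^ sigma * w y <= delta^-1.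
Hypothesis dw_le : forall y : R, 0 < y ->
  `|(1 + y) `^ (sigma + 1) * dw y| <= delta^-1.
Hypothesis phi0 : phi y @[y --> 0^'+] --> (0 : R).

(** On a fibre, [phi], [dphi], [w] and [dw] stand for [ubar], [omegabar], [omega2] and [dy omega2],
    so that [g] is [gbar]. *)
Let g y := dphi y - dw y / w y * phi y.
Let m y := (1 + y) `^ sigma * w y.

Let pow_gt0 (y : R) : 0 < y -> 0 < (1 + y) `^ sigma.
Proof. by move=> y0; rewrite powR_gt0// addr_gt0. Qed.

Let m_gt0 (y : R) : 0 < y -> 0 < m y.
Proof. by move=> y0; rewrite (lt_le_trans delta0)// w_ge. Qed.

Let w_gt0 (y : R) : 0 < y -> 0 < w y.
Proof. by move=> y0; have := m_gt0 y0; rewrite pmulr_rgt0// pow_gt0. Qed.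

Let phi_cont (y : R) : 0 < y -> {for y, continuous phi}.
Proof. by move=> /phiP; exact: is_derive_continuous. Qed.

Let w_cont (y : R) : 0 < y -> {for y, continuous w}.
Proof. by move=> /wP; exact: is_derive_continuous. Qed.

Let g_cont (y : R) : 0 < y -> {for y, continuous g}.
Proof.
move=> y0; apply: cvgB; first exact: dphi_cont.
apply: cvgM; last exact: phi_cont.
apply: cvgM; first exact: dw_cont.
by apply: cvgV; [rewrite gt_eqF// w_gt0|exact: w_cont].
Qed.

Let mP (y : R) : 0 < y ->
  is_derive y 1 m (sigma * m y / (1 + y) + (1 + y) `^ sigma * dw y).
Proof.
move=> y0; have dp := is_derive_powR1D sigma y0; have dw' := wP y0.
by apply: (is_derive_eq (is_deriveM dp dw')); rewrite /GRing.scale/= /m; ring.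
Qed.

Let m_cont (y : R) : 0 < y -> {for y, continuous m}.
Proof. by move=> /mP; exact: is_derive_continuous. Qed.

Let q y := phi y / m y.

(** The logarithmic derivative of [m] is [sigma / (1 + y) + dw / w]. Its second part combines with
    [dphi] into [g], and only the contribution of the weight is left over. *)
Let qP (y : R) : 0 < y ->
  is_derive y 1 q (g y / m y - sigma * q y / (1 + y)).
Proof.
move=> y0; have m0 : m y != 0 by rewrite gt_eqF// m_gt0.
apply: (is_derive_eq (is_derive_div m0 (phiP y0) (mP y0))).
have w0 : w y != 0 by rewrite gt_eqF// w_gt0.
have p0 : (1 + y) `^ sigma != 0 by rewrite gt_eqF// pow_gt0.
have y1 : 1 + y != 0 by rewrite gt_eqF// addr_gt0.
by rewrite /q /g /m; field; rewrite y1 w0 p0.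
Qed.

(** Since [m >= delta], [q] is dominated by [phi / delta] and inherits the vanishing of [phi] at the
    boundary. *)
Let q0 : q y @[y --> 0^'+] --> (0 : R).
Proof.
have K : phi y / delta @[y --> 0^'+] --> (0 : R).
  have : phi y / delta @[y --> 0^'+] --> 0 * delta^-1.
    by apply: cvgM phi0 _; exact: cvg_cst.
  by rewrite mul0r.
apply: norm_cvg0; apply: (squeeze_cvgr _ (cvg_cst 0) ((norm_cvg0P _).2 K)).
near=> y; have y0 : 0 < y by [].
rewrite normr_ge0/= /q !normrM ler_wpM2l// !gtr0_norm ?invr_gt0 ?m_gt0//.
by rewrite lef_pV2 ?posrE ?m_gt0// w_ge.
Unshelve. all: by end_near. Qed.

(** Each passage between weighted and unweighted functions costs a factor [delta ^- 2] on squares: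
    [phi = m * q] uses [m <= delta^-1], and [g / m] uses [m >= delta]. The Hardy inequality for [q]
    in between has constant [1]. *)
Lemma hardy_quotient :
  (\int[mu]_(y in Rpos) ((phi y / (1 + y)) ^+ 2)%:E <=
   (delta ^- 2 ^+ 2)%:E * \int[mu]_(y in Rpos) (g y ^+ 2)%:E)%E.
Proof.
have rc (y : R) : 0 < y -> {for y, continuous (fun y => g y / m y)}.
  move=> y0; apply: cvgM; first exact: g_cont.
  by apply: cvgV; [rewrite gt_eqF// m_gt0|exact: m_cont].
have qc (y : R) : 0 < y -> {for y, continuous q}.
  by move=> /qP; exact: is_derive_continuous.
have h1 : (\int[mu]_(y in Rpos) ((phi y / (1 + y)) ^+ 2)%:E <=
    (delta ^- 2)%:E * \int[mu]_(y in Rpos) ((q y / (1 + y)) ^+ 2)%:E)%E.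
  apply: halfline_ge0_le_integralZ => [|y y0|y y0|y y0|y y0].
  - by rewrite invr_ge0 sqr_ge0.
  - exact/continuous_at_sqr/continuous_div1D/phi_cont.
  - exact/continuous_at_sqr/continuous_div1D/qc.
  - rewrite sqr_ge0/= (_ : phi y = m y * q y); last first.
      by rewrite /q mulrCA divff ?mulr1// gt_eqF// m_gt0.
    rewrite -mulrA exprMn ler_wpM2r ?sqr_ge0// -exprVn lerXn2r ?w_le// nnegrE.
      by rewrite ltW// m_gt0.
    by rewrite invr_ge0 ltW.
  - exact: sqr_ge0.
have h2 := hardy_halfline sigma1 qP rc q0.
have h3 : (\int[mu]_(y in Rpos) ((g y / m y) ^+ 2)%:E <=
    (delta ^- 2)%:E * \int[mu]_(y in Rpos) (g y ^+ 2)%:E)%E.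
  apply: halfline_ge0_le_integralZ => [|y y0|y y0|y y0|y y0].
  - by rewrite invr_ge0 sqr_ge0.
  - exact/continuous_at_sqr/rc.
  - exact/continuous_at_sqr/g_cont.
  - rewrite sqr_ge0/= exprMn mulrC ler_wpM2r ?sqr_ge0// exprVn.
    rewrite lef_pV2 ?posrE ?exprn_gt0 ?m_gt0// lerXn2r ?w_ge// nnegrE ltW//.
    exact: m_gt0.
  - exact: sqr_ge0.
have d2 : 0 <= delta ^- 2 by rewrite invr_ge0 sqr_ge0.
apply: (le_trans h1); rewrite expr2 EFinM -muleA lee_wpmul2l ?lee_fin//.
exact: le_trans h3.
Qed.

(** Here [dphi = g + (dw / w) * phi], and [dw / w] is of size [delta ^- 2 / (1 + y)], so the second
    term is controlled by [hardy_quotient]. *)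
Lemma hardy_quotient_derivative :
  (\int[mu]_(y in Rpos) (dphi y ^+ 2)%:E <=
   ((2 + 2 * delta ^- 4) ^+ 2)%:E * \int[mu]_(y in Rpos) (g y ^+ 2)%:E)%E.
Proof.
have c1 (y : R) : 0 < y -> {for y, continuous (fun y => phi y / (1 + y))}.
  by move=> y0; exact/continuous_div1D/phi_cont.
pose k := delta ^- 2 ^+ 2.
have k0 : 0 <= k by exact: sqr_ge0.
have h1 : (\int[mu]_(y in Rpos) (dphi y ^+ 2)%:E <=
    2%:E * \int[mu]_(y in Rpos) (g y ^+ 2 + k * (phi y / (1 + y)) ^+ 2)%:E)%E.
  apply: halfline_ge0_le_integralZ => [//|y y0|y y0|y y0|y y0].
  - exact/continuous_at_sqr/dphi_cont.
  - apply: cvgD; first exact/continuous_at_sqr/g_cont.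
    by apply: cvgM; [exact: cvg_cst|exact: (continuous_at_sqr (c1 y y0))].
  - rewrite sqr_ge0/=.
    have y1 : 0 < 1 + y by rewrite addr_gt0.
    (* Multiplying and dividing by the weight turns [b] into a quantity bounded by [delta^-1],
       divided by [m >= delta]; hence [b ^+ 2 <= k]. *)
    pose b := dw y / w y * (1 + y).
    have -> : dphi y = g y + b * (phi y / (1 + y)).
      by rewrite /g /b; field; rewrite !gt_eqF// w_gt0.
    have bk : b ^+ 2 <= k.
      rewrite /k -(real_normK (num_real b)) lerXn2r ?nnegrE ?invr_ge0 ?sqr_ge0//.
      have -> : b = (1 + y) `^ (sigma + 1) * dw y / m y.
        rewrite powRD; last by apply/implyP => _; rewrite gt_eqF.
        rewrite powRr1 ?ltW// /b /m; field.
        by rewrite !gt_eqF ?w_gt0 ?pow_gt0.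
      have -> : delta ^- 2 = delta^-1 * delta^-1 by rewrite -invfM.
      rewrite normrM ler_pM// ?dw_le//.
      by rewrite gtr0_norm ?invr_gt0 ?m_gt0// lef_pV2 ?posrE ?m_gt0// w_ge.
    set p := phi y / (1 + y).
    apply: (@le_trans _ _ (2 * (g y ^+ 2 + b ^+ 2 * p ^+ 2))).
      rewrite -subr_ge0 (_ : _ - _ = (g y - b * p) ^+ 2) ?sqr_ge0//.
      by ring.
    by rewrite ler_pM2l// lerD2l ler_wpM2r// sqr_ge0.
  - by rewrite addr_ge0 ?sqr_ge0// mulr_ge0// sqr_ge0.
apply: (le_trans h1).
have mg : measurable_fun Rpos (fun y => (g y ^+ 2)%:E).
  apply/measurable_EFinP; apply: halfline_measurable => y y0.
  exact/continuous_at_sqr/g_cont.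
have mp : measurable_fun Rpos (fun y => ((phi y / (1 + y)) ^+ 2)%:E).
  apply/measurable_EFinP; apply: halfline_measurable => y y0.
  exact/continuous_at_sqr/c1.
under eq_integral do rewrite EFinD (EFinM k).
rewrite ge0_integralD//; last 3 first.
- by move=> y _; rewrite lee_fin sqr_ge0.
- by move=> y _; rewrite mule_ge0// lee_fin sqr_ge0.
- exact: measurable_funeM.
rewrite ge0_integralZl//; last by move=> y _; rewrite lee_fin sqr_ge0.
have I0 : (0 <= \int[mu]_(y in Rpos) (g y ^+ 2)%:E)%E.
  by apply: integral_ge0 => y _; rewrite lee_fin sqr_ge0.
set I := (\int[mu]_(y in _) _)%E in I0 *.
apply: (@le_trans _ _ (2%:E * (I + k%:E * (k%:E * I)))%E).
  by rewrite lee_wpmul2l// leeD2l// lee_wpmul2l ?lee_fin//; exact: hardy_quotient.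
have kk : 0 <= k * k by exact: mulr_ge0.
rewrite muleA -EFinM -{1}(mul1e I) -ge0_muleDl ?lee_fin//.
rewrite -EFinD muleA -EFinM lee_wpmul2r// lee_fin.
(* The factor obtained is [2 * (1 + k ^+ 2)]; the larger [(2 + 2 * k) ^+ 2] is a perfect square,
   which gives a norm constant without radicals. *)
have -> : delta ^- 4 = k by rewrite /k exprVn -exprM.
by nra.
Qed.

End Quotient.
End HalfLine.

(** * Measurability in the plane and integration over the fibres *)

Section Plane.
Set Implicit Arguments.
Unset Strict Implicit.
Context {R : realType}.
Local Notation mu := (@lebesgue_measure R).
Local Notation Rpos := (`]0, +oo[%classic : set R).

(** Measurability in the plane refers to the product sigma-algebra, so an open set is exhibited as a
    countable union of products of balls with rational centres and radii. *)
Lemma open_measurable_prod (A : set (R * R)) : open A -> measurable A.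
Proof.
move=> oA.
pose B (c r : rat) : set R := ball (ratr c : R) (ratr r).
(* Boxes that leave [A] are replaced by [set0], so that the union can run over all rational
   indices. *)
pose E c r c' r' : set (R * R) :=
  if pselect (B c r `*` B c' r' `<=` A) then B c r `*` B c' r' else set0.
have -> : A = \bigcup_c \bigcup_r \bigcup_c' \bigcup_r' E c r c' r'.
  apply/seteqP; split => [[x y] Axy|z [c _ [r _ [c' _ [r' _]]]]]; last first.
    by rewrite /E; case: pselect => // BA /BA.
  have [e/= e0 eA] := (nbhs_ballP _ _).1 (open_nbhs_nbhs (conj oA Axy)).
  have ball_mem (t : R) : t \in (ball t e : set R) by rewrite inE; exact: ballxx.
  have [c [r [xB BA]]] := open_subball_rat (ball_open _ e) (ball_mem x).
  have [c' [r' [yB BA']]] := open_subball_rat (ball_open _ e) (ball_mem y).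
  exists c => //; exists r => //; exists c' => //; exists r' => //.
  rewrite /E; case: pselect => [?|]; last case.
    by split; [exact: (set_mem xB)|exact: (set_mem yB)].
  by move=> [s t] /= [/BA sx /BA' ty]; exact: eA.
do 4 (apply: bigcupT_measurable_rat => ?).
rewrite /E; case: pselect => ?; last exact: measurable0.
by apply: measurableX; apply: open_measurable; exact: ball_open.
Qed.

Lemma open_halfplane : open [set z : R * R | 0 < z.2].
Proof.
have -> : [set z : R * R | 0 < z.2] = snd @^-1` Rpos.
  by apply/seteqP; split => z /=; rewrite in_itv/= andbT.
by apply: open_comp; [move=> z _; exact: cvg_snd|exact: interval_open].
Qed.

Lemma halfplane_measurable (f : R * R -> R) :
  (forall z, 0 < z.2 -> {for z, continuous f}) ->
  measurable_fun [set z : R * R | 0 < z.2] f.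
Proof.
move=> cf mD; apply: (measurability _ (RGenOpens.measurableE R)) => //.
move=> _ [_ [a [b ->]] <-]; apply: open_measurable_prod.
rewrite openE => z /= [z0 fz]; apply: filterI.
  by apply: open_nbhs_nbhs; split => //; exact: open_halfplane.
apply: (cf z z0); apply: open_nbhs_nbhs; split => //; exact: interval_open.
Qed.

Lemma halfplane_measurable_indic (f : R * R -> R) :
  (forall z, 0 < z.2 -> {for z, continuous f}) ->
  measurable_fun setT (f \* \1_Omega).
Proof.
move=> cf; rewrite -patch_indic.
have mO : measurable (Omega : set (R * R)).
  by apply: measurableX; exact: measurable_itv.
apply/(measurable_restrictT f mO).
apply: (measurable_funS _ _ (halfplane_measurable cf)).
  by apply: open_measurable_prod; exact: open_halfplane.
by move=> [x y] [_] /=; rewrite in_itv/= andbT.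
Qed.

(** By Tonelli the squared norm is an iterated integral, so the bound on squares integrates in [x];
    a square root then turns [K ^+ 2] into [K]. *)
Lemma L2norm_le_fibrewise (f g : R * R -> R) (K : R) : 0 <= K ->
  (forall z, 0 < z.2 -> {for z, continuous f}) ->
  (forall z, 0 < z.2 -> {for z, continuous g}) ->
  (forall x, (\int[mu]_(y in Rpos) (f (x, y) ^+ 2)%:E <=
    (K ^+ 2)%:E * \int[mu]_(y in Rpos) (g (x, y) ^+ 2)%:E)%E) ->
  (L2norm f <= K%:E * L2norm g)%E.
Proof.
move=> K0 /halfplane_measurable_indic mf /halfplane_measurable_indic mg fg.
pose S (h : R * R -> R) (z : R * R) : \bar R := (((h \* \1_Omega) z) ^+ 2)%:E.
have S0 h z : (0 <= S h z)%E by rewrite lee_fin sqr_ge0.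
have mS (h : R * R -> R) :
    measurable_fun setT (h \* \1_Omega) -> measurable_fun setT (S h).
  by move=> mh; apply/measurable_EFinP; exact: measurable_funX.
have L2E (h : R * R -> R) : L2norm h = ((\int[(mu \x mu)%E]_z S h z) `^ 2^-1)%E.
  rewrite /L2norm unlock; congr (_ `^ _)%E; apply: eq_integral => z _.
  rewrite /S /comp abse_EFin poweR_EFin powR_mulrn ?normr_ge0//.
  by rewrite real_normK ?num_real.
(* The indicator of [Omega] splits: the factor in [x] comes out of the inner integral, and the
   factor in [y] restricts it to the half-line. *)
have SE (h : R * R -> R) x : (\int[mu]_y S h (x, y) =
    (\1_`[0, 1[ x)%:E * \int[mu]_(y in Rpos) (h (x, y) ^+ 2)%:E)%E.
  rewrite indicE; have [xI|xI] := boolP (x \in _).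
    rewrite mul1e [RHS]integral_mkcond; apply: eq_integral => y _.
    rewrite /S patchE /= indicE in_setX xI/=.
    by case: (y \in _); rewrite ?mulr1// mulr0 expr0n.
  rewrite mul0e; apply: integral0_eq => y _.
  by rewrite /S /= indicE in_setX (negbTE xI) mulr0 expr0n.
rewrite !L2E.
rewrite (@fubini_tonelli1 _ _ _ _ R mu mu _ (mS _ mf) (S0 f)).
rewrite (@fubini_tonelli1 _ _ _ _ R mu mu _ (mS _ mg) (S0 g)).
(* Written as a square root, [K] joins the integral under a single power, whose monotonicity reduces
   the claim to the integrals. *)
have -> : (K%:E = ((K ^+ 2)%:E `^ 2^-1))%E.
  by rewrite poweR_EFin powR12_sqrt ?sqr_ge0// sqrtr_sqr ger0_norm.
have I0 h : (0 <= \int[mu]_x fubini_F mu (S h) x)%E.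
  by apply: integral_ge0 => x _; apply: integral_ge0.
rewrite -poweRM ?lee_fin ?sqr_ge0//; last exact: I0.
have IK : (0 <= (K ^+ 2)%:E * \int[mu]_x fubini_F mu (S g) x)%E.
  by apply: mule_ge0; [rewrite lee_fin sqr_ge0|exact: I0].
apply: gt0_ler_poweR; rewrite ?in_itv/= ?leey ?andbT//; first exact: I0.
have mF (h : R * R -> R) : measurable_fun setT (h \* \1_Omega) ->
    measurable_fun setT (fubini_F mu (S h)).
  by move=> /mS mSh; apply: measurable_fun_fubini_tonelli_F.
rewrite -ge0_integralZl//; last 3 first.
- exact: mF.
- by move=> x _; exact: integral_ge0.
- by rewrite lee_fin sqr_ge0.
apply: ge0_le_integral => //.
- by move=> x _; exact: integral_ge0.
- exact: mF.
- by apply: measurable_funeM; exact: mF.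
- by move=> x _; rewrite /fubini_F !SE muleCA lee_wpmul2l ?lee_fin.
Qed.
End Plane.

(** * Restriction to times and fibres, and pointwise vorticity bounds *)

Section Slices.
Set Implicit Arguments.
Unset Strict Implicit.
Context {R : realType}.
Local Notation mu := (@lebesgue_measure R).

Lemma continuous_at_pair (S T U : topologicalType) (f : S -> T) (g : S -> U) x :
  {for x, continuous f} -> {for x, continuous g} ->
  {for x, continuous (fun s => (f s, g s))}.
Proof.
move=> cf cg; apply: (@cvg_pair _ _ _ (nbhs x) (nbhs (f x)) (nbhs (g x))).
  exact: cf.
exact: cg.
Qed.

(** The point [x] may sit on the edge of [A] as long as [h x] is in [B], so the same statement
    serves interior points and one-sided limits at the boundary. *)
Lemma within_continuous_comp (S T U : topologicalType) (A : set S) (B : set T)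
    (h : S -> T) (f : T -> U) (x : S) :
  {within B, continuous f} -> B (h x) -> {for x, continuous h} ->
  (forall s, A s -> B (h s)) -> f (h s) @[s --> within A (nbhs x)] --> f (h x).
Proof.
move=> /subspace_continuousP cf Bhx ch AB W fW.
have nW : nbhs x [set s | B (h s) -> W (f (h s))] := ch _ (cf _ Bhx W fW).
change (nbhs x [set s | A s -> W (f (h s))]).
by apply: filterS nW => s /= BW /AB; exact: BW.
Qed.

(** A violation at one time would persist, by continuity, on a nonempty open interval inside
    [[0, T]], which has positive measure. *)
Lemma ae_le_within_continuous (T c : R) (f : R -> R) : 0 < T ->
  {within `[0, T], continuous f} ->
  {ae mu, forall t : R, 0 <= t <= T -> f t <= c} ->
  forall t : R, 0 <= t <= T -> f t <= c.
Proof.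
move=> T0 /subspace_continuousP cf aef t tT; rewrite leNgt; apply/negP => ct.
have tI : `[0, T]%classic t by rewrite /= in_itv.
have : \forall s \near t, 0 <= s <= T -> c < f s.
  have H : nbhs t [set s | `[0, T]%classic s -> c < f s] :=
    cf t tI _ (open_nbhs_nbhs (conj (@open_gt R c) ct)).
  by apply: filterS H => s /= h sT; apply: h; rewrite /= in_itv.
move=> /nbhs_ballP[e /= e0 eP].
(* The neighbourhood of [t] is cut down to [[0, T]]; [0 < T] keeps it nonempty even when [t] is an
   endpoint. *)
pose a := Num.max 0 (t - e); pose b := Num.min T (t + e).
move: tT => /andP[t0 tT].
have ab : a < b.
  by rewrite gt_max !lt_min T0/=; apply/and3P; split; lra.
have neg : mu.-negligible `]a, b[%classic.
  apply: negligibleS aef => s /=; rewrite in_itv/= gt_max lt_min.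
  move=> /andP[/andP[s0 ts] /andP[sT se]] /(_ _).
  have sI : 0 <= s <= T by rewrite !ltW.
  move=> /(_ sI); apply/negP; rewrite -ltNge; apply: eP => //.
  by rewrite /ball/= ltr_norml; lra.
have : mu `]a, b[%classic = 0%E by apply: measure_negligible.
rewrite lebesgue_measure_itv/= lte_fin ab -EFinD => /eqP.
by rewrite eqe subr_eq0 gt_eqF.
Qed.

Lemma continuous_inside_time (T : R) (f : R -> R * R -> R) (z : R * R) :
  continuous_inside T f -> 0 < z.2 -> {within `[0, T], continuous (f^~ z)}.
Proof.
move=> cf z0; apply/subspace_continuousP => t /=; rewrite in_itv/= => tT.
apply: (within_continuous_comp (h := fun s => (s, z)) cf) => //.
by apply: continuous_at_pair; [exact: cvg_id|exact: cvg_cst].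
Qed.

(** The half-plane is open, so continuity relative to it is continuity in the full sense at its
    points. *)
Lemma continuous_inside_space (T : R) (f : R -> R * R -> R) (t : R) :
  continuous_inside T f -> 0 <= t <= T ->
  forall z, 0 < z.2 -> {for z, continuous (f t)}.
Proof.
move=> cf tT z z0 W fW.
have ch : {for z, continuous (fun s : R * R => (t, s))}.
  by apply: continuous_at_pair; [exact: cvg_cst|exact: cvg_id].
have nW : nbhs z [set s | 0 < s.2 -> W (f t s)].
  by apply: (within_continuous_comp (A := [set s : R * R | 0 < s.2]) cf) ch _ _ fW.
by apply: filterS2 nW (open_nbhs_nbhs (conj open_halfplane z0)) => s; exact.
Qed.

Lemma continuous_upto_boundary (T : R) (f : R -> R * R -> R) (t x : R) :
  continuous_upto T f -> 0 <= t <= T ->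
  f t (x, y) @[y --> 0^'+] --> f t (x, 0).
Proof.
move=> cf tT.
apply: (within_continuous_comp (h := fun y => (t, (x, y))) cf) => //.
  apply: continuous_at_pair; first exact: cvg_cst.
  by apply: continuous_at_pair; [exact: cvg_cst|exact: cvg_id].
by move=> y /= /ltW.
Qed.

(** The difference quotients of the slice and of [f] along [(0, 1)] are the same function of the
    increment. *)
Lemma is_derive_slice (f : R * R -> R) (x y : R) :
  derivable f (x, y) (0, 1) -> is_derive y 1 (fun y => f (x, y)) (dy f (x, y)).
Proof.
have E (h : R) : h *: ((0, 1) : R * R) + (x, y) = (x, h *: 1 + y).
  by apply: injective_projections; rewrite /= ?scaler0 ?add0r.
have FE :
    (fun h => h^-1 *: (((fun y => f (x, y)) \o shift y) (h *: 1) - f (x, y))) =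
    (fun h => h^-1 *: ((f \o shift (x, y)) (h *: (0, 1)) - f (x, y))).
  by apply/funext => h /=; rewrite E.
by move=> df; apply: DeriveDef; rewrite /derivable /dy /derive FE.
Qed.

(** Each summand of a sum of squares is at most the whole sum; the terms of orders [(0, 0)] and
    [(0, 1)] give the two upper bounds. *)
Lemma Hspace_sd_bounds (s : nat) (gamma sigma delta : R) (f : R * R -> R) :
  0 < delta -> Hspace_sd s gamma sigma delta f ->
  forall z, 0 < z.2 ->
    [/\ delta <= weight sigma z * f z, weight sigma z * f z <= delta^-1 &
        `|weight (sigma + 1) z * dy f z| <= delta^-1].
Proof.
move=> d0 [_ _ fge fle] z z0.
have term (a b : nat) : (a + b <= 1)%N ->
    `|weight (sigma + b%:R) z * Dxy a b f z| <= delta^-1.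
  move=> ab; rewrite -(@ler_pXn2r _ 2) ?nnegrE ?invr_ge0 ?(ltW d0)// exprVn.
  apply: le_trans (fle z z0).
  have a3 : (a < 3)%N by rewrite (leq_ltn_trans (leq_trans (leq_addr b a) ab)).
  have b3 : (b < 3)%N by rewrite (leq_ltn_trans (leq_trans (leq_addl a b) ab)).
  rewrite (bigD1 (Ordinal a3))//= (bigD1 (Ordinal b3))/= ?(leq_trans ab)//.
  rewrite -addrA lerDl addr_ge0// ?sumr_ge0// => i _; rewrite ?sqr_ge0//.
  by rewrite sumr_ge0// => j _; exact: sqr_ge0.
have := term 0%N 0%N isT; have := term 0%N 1%N isT.
rewrite addr0 => h1 h0; split => //; first exact: fge.
exact: le_trans (ler_norm _) h0.
Qed.

(* [solution_class] bounds the vorticity for almost every time only; continuity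
   in time extends the pointwise bounds to every time. *)
Lemma vorticity_bounds (s : nat) (gamma sigma delta T : R) (w : R -> R * R -> R) :
  0 < T -> 0 < delta ->
  continuous_inside T w -> continuous_inside T (fun t => dy (w t)) ->
  Linfty T (Hnorm s gamma) (Hspace_sd s gamma sigma delta) w ->
  forall (t : R) z, 0 <= t <= T -> 0 < z.2 ->
    [/\ delta <= weight sigma z * w t z, weight sigma z * w t z <= delta^-1 &
        `|weight (sigma + 1) z * dy (w t) z| <= delta^-1].
Proof.
move=> T0 d0 cw cdw [M aew] t z tT z0.
have ae_le (f : R -> R) c : {within `[0, T], continuous f} ->
    (forall r, Hspace_sd s gamma sigma delta (w r) -> f r <= c) -> f t <= c.
  move=> cf fc; apply: ae_le_within_continuous tT => //.
  by apply: negligibleS aew => r /= fr wr; apply: fr => /wr[] /fc.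
have cw' := continuous_inside_time cw z0.
have cdw' := continuous_inside_time cdw z0.
have cst_mul (k : R) (f : R -> R) : {within `[0, T], continuous f} ->
    {within `[0, T], continuous (fun r => k * f r)}.
  by move=> cf r; apply: cvgM; [exact: cvg_cst|exact: cf].
split.
(* As [ae_le] propagates upper bounds, the lower bound is passed through the opposite function. *)
- rewrite -lerN2 -mulNr; apply: (ae_le (fun r => - weight sigma z * w r z)).
    exact: cst_mul.
  move=> r /(Hspace_sd_bounds d0)/(_ z z0)[+ _ _].
  by rewrite mulNr lerN2.
- apply: (ae_le (fun r => weight sigma z * w r z)); first exact: cst_mul.
  by move=> r /(Hspace_sd_bounds d0)/(_ z z0)[].
- apply: (ae_le (fun r => `|weight (sigma + 1) z * dy (w r) z|)).
    by move=> r; apply: cvg_norm; exact: (cst_mul _ _ cdw').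
  by move=> r /(Hspace_sd_bounds d0)/(_ z z0)[].
Qed.

Lemma dy_div (f g : R * R -> R) z : g z != 0 ->
  derivable f z (0, 1) -> derivable g z (0, 1) ->
  dy (fun w => f w / g w) z = dy f z / g z - f z * dy g z / g z ^+ 2.
Proof.
case: z => x y g0 df dg.
have dfg : derivable (fun w => f w / g w) (x, y) (0, 1).
  by apply: derivableM => //; exact: derivableV.
have [_ <-] := is_derive_slice dfg.
have [_ ->] := is_derive_div g0 (is_derive_slice df) (is_derive_slice dg).
by [].
Qed.

End Slices.

(** * From fibre estimates to the difference of two solutions *)

Theorem lemma4p1 (R : realType) :
  exists C : R -> R -> R,
  forall (n gamma sigma delta T : R) (s : nat)
         (U p : R -> R -> R) (u0 : R * R -> R) (u1 v1 u2 v2 : R -> R * R -> R),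
    admissible n gamma sigma delta s ->
    0 < T ->
    outer_flow T U p ->
    classical_solution n T U p u0 u1 v1 ->
    classical_solution n T U p u0 u2 v2 ->
    solution_class s gamma sigma delta T U u1 ->
    solution_class s gamma sigma delta T U u2 ->
    forall t : R, 0 <= t <= T ->
      let omega1 := dy (u1 t) in
      let omega2 := dy (u2 t) in
      let ubar := fun z : R * R => u1 t z - u2 t z in
      let omegabar := fun z : R * R => omega1 z - omega2 z in
      let a2 := fun z : R * R => dy omega2 z / omega2 z in
      let gbar := fun z : R * R => omegabar z - a2 z * ubar z in
      (forall z : R * R, 0 < z.2 ->
         gbar z = omega2 z * dy (fun w : R * R => ubar w / omega2 w) z) /\
      (L2norm (fun z : R * R => (ubar z / (1 + z.2))%R) + L2norm omegabar
         <= (C sigma delta)%:E * L2norm gbar)%E.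
Proof.
(* The sum of the constants for [ubar / (1 + y)] and for [omegabar]. *)
exists (fun _ delta => delta ^- 2 + (2 + 2 * delta ^- 4)).
move=> n gamma sigma delta T s U p u0 u1 v1 u2 v2.
move=> [_ _ gamma1 /andP[gs _] /andP[d0 _]] T0 _ S1 S2 _ [_ C2] t tT.
move=> omega1 omega2 ubar omegabar a2 gbar.
have [cu1 _] := sol_continuous S1; have [cu2 _] := sol_continuous S2.
have [_ cw1 _ _] := sol_derivative_continuous S1.
have [_ cw2 cdw2 _] := sol_derivative_continuous S2.
have bnd z := vorticity_bounds T0 d0 cw2 cdw2 C2 tT (z := z).
have w0 z : 0 < z.2 -> 0 < omega2 z.
  move=> z0; have [+ _ _] := bnd z z0; move=> /(lt_le_trans d0).
  by rewrite pmulr_rgt0// powR_gt0// addr_gt0.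
have dubar z : 0 < z.2 -> derivable ubar z (0, 1).
  move=> z0; have [_ d1 _ _] := sol_derivable S1 tT z0.
  by have [_ d2 _ _] := sol_derivable S2 tT z0; exact: derivableB.
have dubarE z : 0 < z.2 -> dy ubar z = omegabar z.
  move=> z0; have [_ d1 _ _] := sol_derivable S1 tT z0.
  by have [_ d2 _ _] := sol_derivable S2 tT z0; rewrite /dy deriveB.
have dw z : 0 < z.2 -> derivable omega2 z (0, 1).
  by move=> z0; have [] := sol_derivable S2 tT z0.
split=> [z z0|].
  have wz : omega2 z != 0 by rewrite gt_eqF// w0.
  by rewrite (dy_div wz (dubar z z0) (dw z z0)) (dubarE z z0) /gbar /a2; field.
(* Admissibility gives [sigma > gamma + 1 / 2 >= 3 / 2]. *)
have sigma1 : 1 <= 2 * sigma by lra.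
have cw1t := continuous_inside_space cw1 tT.
have cw2t := continuous_inside_space cw2 tT.
have cdw2t := continuous_inside_space cdw2 tT.
have cut (u : R -> R * R -> R) : continuous_upto T u ->
    forall z, 0 < z.2 -> {for z, continuous (u t)}.
  move=> cu; apply: continuous_inside_space tT.
  by apply: continuous_subspaceW cu => q [qT /ltW].
have cubar z : 0 < z.2 -> {for z, continuous ubar}.
  by move=> z0; apply: cvgB; exact: cut.
have comegabar z : 0 < z.2 -> {for z, continuous omegabar}.
  by move=> z0; apply: cvgB; [exact: cw1t|exact: cw2t].
have cgbar z : 0 < z.2 -> {for z, continuous gbar}.
  move=> z0; apply: cvgB; first exact: comegabar.
  apply: cvgM; last exact: cubar.
  apply: cvgM; first exact: cdw2t.
  by apply: cvgV; [rewrite gt_eqF// w0|exact: cw2t].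
have cquot z : 0 < z.2 ->
    {for z, continuous (fun z : R * R => ubar z / (1 + z.2))}.
  move=> z0; apply: cvgM; first exact: cubar.
  apply: cvgV; first by rewrite gt_eqF// addr_gt0.
  by apply: cvgD; [exact: cvg_cst|exact: cvg_snd].
have slice (f : R * R -> R) x : (forall z, 0 < z.2 -> {for z, continuous f}) ->
    forall y : R, 0 < y -> {for y, continuous (fun y => f (x, y))}.
  move=> cf y y0; apply: (@continuous_comp _ _ _ (fun y => (x, y)) f).
    by apply: continuous_at_pair; [exact: cvg_cst|exact: cvg_id].
  exact: cf.
(* Both velocities are continuous up to [y = 0] and vanish there by the no-slip condition. *)
have ubar0 x : ubar (x, y) @[y --> 0^'+] --> (0 : R).
  have [h1 _] := sol_boundary S1 x tT; have [h2 _] := sol_boundary S2 x tT.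
  have : ubar (x, y) @[y --> 0^'+] --> u1 t (x, 0) - u2 t (x, 0).
    by apply: cvgB; apply: continuous_upto_boundary tT.
  by rewrite h1 h2 subrr.
have ubarP x (y : R) : 0 < y ->
    is_derive y 1 (fun y => ubar (x, y)) (omegabar (x, y)).
  move=> y0; rewrite -dubarE//; apply: is_derive_slice; exact: dubar.
have wP x (y : R) : 0 < y ->
    is_derive y 1 (fun y => omega2 (x, y)) (dy omega2 (x, y)).
  by move=> y0; apply: is_derive_slice; exact: dw.
have N1 : (L2norm (fun z : R * R => (ubar z / (1 + z.2))%R) <=
    (delta ^- 2)%:E * L2norm gbar)%E.
  apply: L2norm_le_fibrewise => // [|x]; first by rewrite invr_ge0 sqr_ge0.
  apply: (hardy_quotient sigma1 d0 (ubarP x) (wP x) (slice _ x comegabar)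
    (slice _ x cdw2t) _ _ (ubar0 x)) => y y0.
    by have [] := bnd (x, y) y0.
  by have [] := bnd (x, y) y0.
have N2 : (L2norm omegabar <= (2 + 2 * delta ^- 4)%:E * L2norm gbar)%E.
  apply: L2norm_le_fibrewise => // [|x].
    by rewrite addr_ge0// mulr_ge0// invr_ge0 exprn_ge0// ltW.
  apply: (hardy_quotient_derivative sigma1 d0 (ubarP x) (wP x)
    (slice _ x comegabar) (slice _ x cdw2t) _ _ _ (ubar0 x)) => y y0.
  - by have [] := bnd (x, y) y0.
  - by have [] := bnd (x, y) y0.
  - by have [] := bnd (x, y) y0.
rewrite EFinD ge0_muleDl ?leeD//.
  by rewrite lee_fin invr_ge0 sqr_ge0.
by rewrite lee_fin addr_ge0// mulr_ge0// invr_ge0 exprn_ge0// ltW.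
Qed.
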